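(* Let $d \geq 1$ be an integer and suppose there exists a skew Hadamard matrix of order $d+1$. Then there exists an equiangular tight frame (ETF) of size $d \times 2d$ with complex entries. Consequently, the Welch bound gives the optimal coherence of $2d$ lines in $\mathbb{C}^d$: the minimum of $\max_{i \neq j} |f_i^* f_j|$ over all choices of $2d$ unit vectors $f_1,\dotsc,f_{2d} \in \mathbb{C}^d$ is attained and equals $\sqrt{\frac{n-d}{d(n-1)}}$ with $n = 2d$, that is, $\frac{1}{\sqrt{2d-1}}$.
   Context: A Hadamard matrix of order $m$ is an $m \times m$ matrix $H$ with entries in $\{1,-1\}$ satisfying $H^\top H = mI$. A skew Hadamard matrix is a Hadamard matrix of the form $H = C + I$ with $C^\top = -C$. For $n > d \geq 1$, an equiangular tight frame (ETF) of size $d \times n$ is a matrix $F = [f_1 \cdots f_n] \in \mathbb{C}^{d \times n}$ with unit-norm columns such that (i) $|f_i^* f_j| = \mu$ for all $i \neq j$, where $\mu = \sqrt{\frac{n-d}{d(n-1)}}$, and (ii) $FF^* = \frac{n}{d} I$. The coherence of lines in $\mathbb{C}^d$ spanned by unit vectors $f_1,\dotsc,f_n \in \mathbb{C}^d$ (with $n \geq 2$) is $\max_{i \neq j} |f_i^* f_j|$. The Welch bound is the fact that, for $n > d$, this coherence is always at least $\mu = \sqrt{\frac{n-d}{d(n-1)}}$, with equality if and only if $F$ is an ETF. (Lines in an arrangement are allowed to repeat.) *)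

(* Defs.v *)
From mathcomp Require Import all_boot all_order all_algebra.
From mathcomp Require Import complex reals.

Set Implicit Arguments.
Unset Strict Implicit.
Unset Printing Implicit Defensive.

Import Order.TTheory GRing.Theory Num.Theory.
Local Open Scope ring_scope.
Local Open Scope complex_scope.
Local Open Scope sesquilinear_scope.

Definition hadamard (m : nat) (H : 'M[int]_m) : Prop :=
  (forall i j, H i j = 1 \/ H i j = - 1) /\ H^T *m H = m%:R%:M.

Definition skew_hadamard (m : nat) (H : 'M[int]_m) : Prop :=
  hadamard H /\ exists2 C : 'M[int]_m, H = C + 1%:M & C^T = - C.

(* The real-valued modulus [normc : R[i] -> R] is used rather than the norm
   [`|_|] of [R[i]], which takes its values in [R[i]]. *)
Definition modulus (R : realType) (z : R[i]) : R := ComplexField.Normc.normc z.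

(* The norm provided on matrices by the analysis library is the sup norm;
   this is the Euclidean one. *)
Definition enorm (R : realType) (d : nat) (u : 'cV[R[i]]_d) : R :=
  Num.sqrt (\sum_(k < d) modulus (u k 0) ^+ 2).

Definition cdot (R : realType) (d : nat) (u v : 'cV[R[i]]_d) : R[i] :=
  (u ^t* *m v) 0 0.

Definition unit_columns (R : realType) (d n : nat) (F : 'M[R[i]]_(d, n)) : Prop :=
  forall j, enorm (col j F) = 1.

Definition welch (R : realType) (d n : nat) : R :=
  Num.sqrt ((n%:R - d%:R) / (d%:R * (n%:R - 1))).

Definition is_etf (R : realType) (d n : nat) (F : 'M[R[i]]_(d, n)) : Prop :=
  [/\ (1 <= d < n)%N,
      unit_columns F,
      forall i j, i != j -> modulus (cdot (col i F) (col j F)) = welch R d n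
    & F *m F ^t* = (n%:R / d%:R)%:M].

(* All the terms are nonnegative, so for [2 <= n] the default value 0 does not
   affect the maximum. *)
Definition coherence (R : realType) (d n : nat) (F : 'M[R[i]]_(d, n)) : R :=
  \big[Num.max/0]_(p : 'I_n * 'I_n | p.1 != p.2)
    modulus (cdot (col p.1 F) (col p.2 F)).

(* Main.v *)
Require Import Defs.
From mathcomp Require Import all_boot all_order all_algebra.
From mathcomp Require Import complex reals.
From mathcomp Require Import ring.

(** A d x 2d matrix with unit columns is an equiangular tight frame exactly
    when its Gram matrix is G = I + m S, where m is the Welch bound and S is
    Hermitian with zero diagonal, unimodular entries off the diagonal and
    S^2 = (2d - 1) I.  Such an S (a Hermitian conference matrix of order 2d) is
    all that is needed: since m^2 (2d - 1) = 1, the matrix P = G / 2 is an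
    orthogonal projection, and its rank is its trace, d.  An orthonormal basis
    of the row space of P, written as the rows of V, gives P = V^* V, and
    sqrt 2 V is the frame ([tight_frame_of_conference],
    [etf_of_hermitian_conference]).

    To build S from a skew Hadamard matrix H = C + I of order d + 1, note that
    C^2 = - d I.  Changing the signs of rows and columns of C symmetrically, so
    that one row becomes constant off the diagonal, and deleting that row and
    column leaves a real skew matrix Q of order d with Q J = J Q = 0 and
    Q^2 = J - d I, where J is the all-ones matrix ([skew_hadamard_core]).  Then
<<
       S = [ iQ                    w J + i t (Q + I) ]
           [ w J + i t (Q - I)     - iQ              ]
>>
    with w^2 = 2 / (d + 1) and t^2 = (d - 1) / (d + 1).  Since w^2 + t^2 = 1, and
    the entries of Q + I and Q - I are 1 or -1, the off-diagonal blocks are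
    unimodular.  All blocks commute, as Q and J do, so the off-diagonal blocks
    of S^2 cancel; its diagonal blocks equal
<<
       - (1 + t^2) Q^2 + w^2 d J + t^2 I = (w^2 d - 1 - t^2) J + (d + t^2 (d + 1)) I
                                         = (2d - 1) I
>>
    ([hermitian_conference_of_core]).

    Optimality is the Welch bound ([welch_le_coherence]): the Frobenius norm of
    F F^* - (n / d) I is nonnegative, which bounds the sum of the |f_i^* f_j|^2
    from below by n^2 / d; the average over i <> j is then at least the square
    of the Welch bound. *)

Set Implicit Arguments.
Unset Strict Implicit.
Unset Printing Implicit Defensive.

Import Order.TTheory GRing.Theory Num.Theory.
Local Open Scope ring_scope.
Local Open Scope sesquilinear_scope.

(** * Orthogonal projections *)

(** In the factorization P = (col_base P) (row_base P) the outer factors can be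
    cancelled from P P = P, so the product in the other order is the identity
    matrix of size rank P, and it has the same trace as P. *)
Lemma mxtrace_idempotent (K : fieldType) (n : nat) (P : 'M[K]_n) :
  P *m P = P -> \tr P = (\rank P)%:R.
Proof.
move=> PP; have RC1 : row_base P *m col_base P = 1%:M.
  have : col_base P *m (row_base P *m col_base P) *m row_base P =
         col_base P *m 1%:M *m row_base P.
    by rewrite mulmx1 mulmxA mulmx_base -mulmxA mulmx_base PP.
  move=> /(row_free_inj (row_base_free P)).
  by move=> /(row_full_inj (col_base_full P)).
by rewrite -[in LHS](mulmx_base P) mxtrace_mulC RC1 mxtrace1.
Qed.

Lemma adjmxM (C : numClosedFieldType) m n p (A : 'M[C]_(m, n)) (B : 'M[C]_(n, p)) :
  (A *m B)^t* = B^t* *m A^t*.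
Proof. by rewrite trmx_mul map_mxM. Qed.

Lemma adjmxK (C : numClosedFieldType) m n (A : 'M[C]_(m, n)) : A^t*^t* = A.
Proof. by apply/matrixP=> i j; rewrite !mxE conjCK. Qed.

Lemma adjmxD (C : numClosedFieldType) m n (A B : 'M[C]_(m, n)) :
  (A + B)^t* = A^t* + B^t*.
Proof. by rewrite linearD map_mxD. Qed.

Lemma adjmxZ (C : numClosedFieldType) m n a (A : 'M[C]_(m, n)) :
  (a *: A)^t* = a^* *: A^t*.
Proof. by rewrite linearZ map_mxZ. Qed.

(** The rows of V form an orthonormal basis of the row space of P, obtained by
    the Gram-Schmidt process. *)
Lemma orthogonal_projection_factor (C : numClosedFieldType) (n : nat) (P : 'M[C]_n) :
    P *m P = P -> P^t* = P ->
  exists2 V : 'M[C]_(\rank P, n), V *m V^t* = 1%:M & V^t* *m V = P.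
Proof.
move=> PP Pherm; pose V := schmidt (row_base P).
have eVP : (V :=: P)%MS.
  exact: eqmx_trans (eqmx_schmidt_free (row_base_free P)) (eq_row_base P).
have VV : V *m V^t* = 1%:M.
  by apply/unitarymxP/schmidt_unitarymx/rank_leq_col.
exists V => //.
have VP : V *m P = V.
  by have /submxP[B ->] : (V <= P)%MS by [rewrite eVP]; rewrite -mulmxA PP.
have /submxP[A PA] : (P <= V)%MS by rewrite eVP.
have PV : P *m V^t* = V^t* by rewrite -[in RHS]VP adjmxM Pherm.
have : (A *m V) *m V^t* = V^t* by rewrite -PA.
by rewrite -mulmxA VV mulmx1 => <-.
Qed.

(** * From a skew Hadamard matrix to a Hermitian conference matrix *)

(** This is what remains of the skew part of a normalized skew Hadamard matrix
    of order d + 1 after deleting its constant row and column. *)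
Definition skew_core (d : nat) (Q : 'M[int]_d) : Prop :=
  [/\ Q^T = - Q,
      forall i, Q i i = 0,
      forall i j, i != j -> Q i j = 1 \/ Q i j = -1,
      Q *m const_mx 1 = 0 :> 'M_d
    & Q *m Q = const_mx 1 - d%:R%:M].

(** The deleted row is the last one, which pairs the d remaining indices l j
    with the sign c j of C at (o, l j).  Conjugating by these signs normalizes C,
    so that Q has entries c_i C_ij c_j.  Both identities on Q then come from
    C^2 = - d I by splitting off the term of index o from the sum. *)
Lemma skew_hadamard_core (d : nat) (H : 'M[int]_(d + 1)) :
  skew_hadamard H -> exists Q : 'M[int]_d, skew_core Q.
Proof.
case=> -[Hpm HH] [C HC CT].
have skewC i j : C j i = - C i j.
  by have := congr1 (fun M : 'M_ _ => M i j) CT; rewrite !mxE.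
have diagC i : C i i = 0.
  have : C i i *+ 2 = 0 by rewrite mulr2n {1}skewC addNr.
  by move/eqP; rewrite mulrn_eq0 => /eqP.
have signC i j : i != j -> C i j = 1 \/ C i j = -1.
  by move=> /negPf ij; have := Hpm i j; rewrite HC !mxE ij addr0.
have CC i j : \sum_k C i k * C k j = - (d%:R *+ (i == j)).
  have HTH : H^T *m H = 1%:M - C *m C.
    have -> : H^T = 1%:M - C by rewrite HC linearD /= CT trmx1 addrC.
    by rewrite HC mulmxDr mulmx1 mulmxBl mul1mx addrC addrA subrK.
  have : C *m C = 1%:M - (d + 1)%:R%:M by rewrite -HH HTH subKr.
  move=> /(congr1 (fun M : 'M_ _ => M i j)); rewrite !mxE => ->.
  by rewrite natrD mulrnDl opprD addrCA subrr addr0.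
pose o : 'I_(d + 1) := rshift d ord0.
pose l (j : 'I_d) : 'I_(d + 1) := lshift 1 j.
have lo j : o != l j by rewrite eq_sym eq_lrshift.
have ll i j : (l i == l j) = (i == j) by rewrite eq_lshift.
pose c j := C o (l j).
have cc j : c j * c j = 1 by rewrite /c; case: (signC o (l j) (lo j)) => ->.
have cE j : c j = - C (l j) o by exact: skewC.
(* This is C^2 = - d I, with the term k = o moved to the right-hand side. *)
have split i j : \sum_k C (l i) (l k) * C (l k) j =
    - (d%:R *+ (l i == j)) + c i * C o j.
  by rewrite -CC big_split_ord /= big_ord1 -/o cE mulNr addrK.
exists (\matrix_(i, j) (c i * C (l i) (l j) * c j)); split.
- by apply/matrixP=> i j; rewrite !mxE skewC; ring.
- by move=> i; rewrite !mxE diagC mulr0 mul0r.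
- move=> i j ij; rewrite !mxE /c.
  case: (signC o (l i) (lo i)) => ->; case: (signC o (l j) (lo j)) => ->;
  case: (signC (l i) (l j)); rewrite ?ll // => ->; by [left | right].
- apply/matrixP=> i j; rewrite !mxE.
  under eq_bigr => k _ do rewrite !mxE mulr1 (cE k) mulrN -mulrA.
  rewrite sumrN -mulr_sumr split diagC eq_sym (negPf (lo i)).
  by rewrite mulr0n oppr0 mulr0 addr0 mulr0 oppr0.
- apply/matrixP=> i j; rewrite !mxE.
  have E k : (\matrix_(i, j) (c i * C (l i) (l j) * c j)) i k *
     (\matrix_(i, j) (c i * C (l i) (l j) * c j)) k j =
     c i * c j * (C (l i) (l k) * C (l k) (l j)).
    by rewrite !mxE -[RHS]mulr1 -(cc k); ring.
  under eq_bigr => k _ do rewrite E.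
  rewrite -mulr_sumr split -/(c j) mulrDr mulrACA !cc ll.
  by have [-> | _] := eqVneq i j; rewrite ?cc ?mulr1n ?mulr0n; ring.
Qed.

Definition hermitian_conference (C : numClosedFieldType) (n : nat)
    (S : 'M[C]_n) : Prop :=
  [/\ S^t* = S, forall i, S i i = 0, forall i j, i != j -> `|S i j| = 1
    & S *m S = (n%:R - 1)%:M].

(** A 2 x 2 block matrix in the commutative algebra generated by Q and J.  The
    diagonal blocks iQ and - iQ are opposite so that the off-diagonal blocks of
    the square cancel; this leaves two equations for w and t, one for the
    coefficient of J and one for that of I. *)
Lemma hermitian_conference_of_core (C : numClosedFieldType) (d : nat)
    (Q0 : 'M[int]_d) : (0 < d)%N -> skew_core Q0 ->
  exists S : 'M[C]_(d + d), hermitian_conference S.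
Proof.
move=> hd [Q0skew Q0diag Q0pm Q0J Q0Q0].
pose J : 'M[C]_d := const_mx 1; pose Q : 'M[C]_d := map_mx intr Q0.
have JE : map_mx intr (const_mx 1 : 'M[int]_d) = J by rewrite map_const_mx.
have Qskew : Q^t* = - Q.
  rewrite /Q -map_mxN -Q0skew; apply/matrixP=> i j; rewrite !mxE.
  by rewrite rmorph_int.
have QJ : Q *m J = 0 by rewrite -JE -map_mxM Q0J map_mx0.
have QQ : Q *m Q = J - d%:R%:M.
  by rewrite -map_mxM Q0Q0 map_mxB JE map_scalar_mx rmorph_nat.
have Qdiag i : Q i i = 0 by rewrite mxE Q0diag.
have Qpm i j : i != j -> Q i j = 1 \/ Q i j = -1.
  by move=> /Q0pm[] E; rewrite mxE E ?rmorphN rmorph1; [left | right].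
have JT : J^t* = J by apply/matrixP=> i j; rewrite !mxE rmorph1.
have JQ : J *m Q = 0.
  by rewrite -[LHS]adjmxK adjmxM JT Qskew mulNmx QJ oppr0 trmx0 map_mx0.
have JJ : J *m J = d%:R *: J.
  apply/matrixP=> i j; rewrite !mxE.
  by under eq_bigr do rewrite !mxE mulr1; rewrite sumr_const card_ord mulr1.
have dS : d.+1%:R = d%:R + 1 :> C by rewrite natr1.
have d1 : d.+1%:R != 0 :> C by rewrite pnatr_eq0.
pose w : C := sqrtC (2 / d.+1%:R); pose t : C := sqrtC (d.-1%:R / d.+1%:R).
have w_ge0 : 0 <= w by rewrite sqrtC_ge0 divr_ge0.
have t_ge0 : 0 <= t by rewrite sqrtC_ge0 divr_ge0.
have wJ : w^* = w by apply/CrealP/ger0_real.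
have tJ : t^* = t by apply/CrealP/ger0_real.
have dE : d.-1%:R = d%:R - 1 :> C by rewrite -[in RHS](prednK hd) mulrSr addrK.
have ww : w * w = 2 / (d%:R + 1) by rewrite -expr2 sqrtCK dS.
have tt : t * t = (d%:R - 1) / (d%:R + 1) by rewrite -expr2 sqrtCK dE dS.
(* The first equation cancels J in the diagonal blocks of the square, and the
   second one makes the remaining scalar 2d - 1. *)
have wwd : w * w * d%:R = 1 + t * t by rewrite ww tt; field; rewrite -dS.
have ttd : t * t * d%:R = d%:R - 1 - t * t by rewrite tt; field; rewrite -dS.
have ii : 'i * 'i = -1 :> C by rewrite -expr2 sqrCi.
have norm_entry e : e = 1 \/ e = -1 -> `|w + 'i * t * e| = 1.
  move=> he; apply/eqP; rewrite -(@pexpr_eq1 _ _ 2) //; apply/eqP.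
  have te_real : t * e \is Num.real.
    by case: he => ->; rewrite ?mulrN mulr1 ?realN; apply: ger0_real.
  rewrite -mulrA normC2_rect ?(ger0_real w_ge0) //.
  have -> : (t * e) ^+ 2 = t * t by case: he => ->; ring.
  by rewrite expr2 ww tt; field; rewrite -dS.
pose B := w *: J + ('i * t) *: (Q + 1%:M).
pose B' := w *: J + ('i * t) *: (Q + (-1)%:M).
have adj1 : (1%:M : 'M[C]_d)^t* = 1%:M by rewrite trmx1 map_mx1.
have adjB : B^t* = B'.
  rewrite /B /B' adjmxD !adjmxZ adjmxD JT Qskew adj1 rmorphM /= conjCi wJ tJ.
  by rewrite mulNr scaleNr -scalerN opprD opprK raddfN.
have adjB' : B'^t* = B by rewrite -adjB adjmxK.
have adjQ : ('i *: Q)^t* = 'i *: Q.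
  by rewrite adjmxZ Qskew conjCi scaleNr scalerN opprK.
have mulB e f : e + f = 0 -> e * f = -1 ->
    (w *: J + ('i * t) *: (Q + e%:M)) *m (w *: J + ('i * t) *: (Q + f%:M)) =
    J + (d%:R - 1)%:M.
  move=> /eqP; rewrite addr_eq0 => /eqP-> /eqP; rewrite mulNr eqr_opp => /eqP ff.
  rewrite !(mulmxDl, mulmxDr) -!(scalemxAl, scalemxAr) !(mulmxDl, mulmxDr).
  rewrite JJ QJ JQ QQ !mul_mx_scalar !mul_scalar_mx -/J.
  apply/matrixP=> i j; rewrite !mxE; ring: ii wwd ttd ff.
have commB e : Q *m (w *: J + ('i * t) *: (Q + e%:M)) =
               (w *: J + ('i * t) *: (Q + e%:M)) *m Q.
  rewrite !(mulmxDl, mulmxDr) -!(scalemxAl, scalemxAr) !(mulmxDl, mulmxDr).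
  by rewrite QJ JQ mul_mx_scalar mul_scalar_mx.
exists (block_mx ('i *: Q) B B' (- ('i *: Q))); split.
- by rewrite tr_block_mx map_block_mx adjB adjB' !linearN /= map_mxN adjQ.
- move=> u; rewrite -[u]splitK; case: (fintype.split u) => k /=.
    by rewrite block_mxEul mxE Qdiag mulr0.
  by rewrite block_mxEdr mxE [in LHS]mxE Qdiag mulr0 oppr0.
- have Bnorm k l : `|B k l| = 1.
    have -> : B k l = w + 'i * t * (Q k l + (k == l)%:R).
      by rewrite !mxE mulr1.
    apply: norm_entry.
    have [-> | /Qpm] := eqVneq k l; last by rewrite addr0.
    by rewrite Qdiag add0r; left.
  have iQnorm k l : k != l -> `|('i *: Q) k l| = 1.
    move=> /Qpm E; rewrite mxE normrM normCi mul1r.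
    by case: E => ->; rewrite ?normrN normr1.
  move=> u v; rewrite -[u]splitK -[v]splitK.
  case: (fintype.split u) => k; case: (fintype.split v) => l /= kl.
  + by rewrite block_mxEul iQnorm // -(inj_eq (@lshift_inj _ d)).
  + by rewrite block_mxEur.
  + by rewrite block_mxEdl -adjB 2!mxE norm_conjC Bnorm.
  + by rewrite block_mxEdr mxE normrN iQnorm // -(inj_eq (@rshift_inj d _)).
- have BB' : B *m B' = J + (d%:R - 1)%:M by apply: mulB; rewrite ?subrr ?mul1r.
  have B'B : B' *m B = J + (d%:R - 1)%:M by apply: mulB; rewrite ?addNr ?mulr1.
  rewrite mulmx_block scalar_mx_block BB' B'B !(mulmxN, mulNmx) opprK.
  rewrite -!(scalemxAl, scalemxAr) !commB !subrr QQ scalerA ii.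
  suff E : -1 *: (J - d%:R%:M) + (J + (d%:R - 1)%:M) = ((d + d)%:R - 1)%:M.
    by rewrite E [X in block_mx _ _ _ X]addrC E.
  by apply/matrixP=> i j; rewrite !mxE natrD; ring.
Qed.

(** * From a Hermitian conference matrix to an equiangular tight frame *)

(** With G = I + m S, the hypotheses give G^2 = 2 G.  So G / 2 is an orthogonal
    projection of trace d, hence of rank d: this is where the number of vectors
    being twice the dimension enters. *)
Lemma tight_frame_of_conference (C : numClosedFieldType) (d : nat)
    (S : 'M[C]_(d + d)) (m : C) :
    S^t* = S -> (forall i, S i i = 0) -> S *m S = ((d + d)%:R - 1)%:M ->
    m^* = m -> m * m * ((d + d)%:R - 1) = 1 ->
  exists F : 'M[C]_(d, d + d),
    F *m F^t* = 2%:M /\ F^t* *m F = 1%:M + m *: S.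
Proof.
move=> Sherm Sdiag SS mJ m2.
have two_neq0 : 2 != 0 :> C by rewrite pnatr_eq0.
pose P := 2^-1 *: (1%:M + m *: S).
have Pherm : P^t* = P.
  by rewrite adjmxZ adjmxD adjmxZ Sherm mJ fmorphV rmorph_nat trmx1 map_mx1.
have PP : P *m P = P.
  rewrite -scalemxAl -scalemxAr scalerA mulmxDl !mulmxDr -!scalemxAl -!scalemxAr.
  rewrite !mul1mx !mulmx1 SS !scale_scalar_mx mulrA m2.
  by apply/matrixP=> i j; rewrite !mxE; field.
have rP : \rank P = d.
  apply/eqP; rewrite -(eqr_nat C) -(mxtrace_idempotent PP) mxtraceZ mxtraceD mxtrace1.
  by rewrite mxtraceZ [\tr S]big1 // mulr0 addr0 natrD; apply/eqP; field.
have [] := orthogonal_projection_factor PP Pherm.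
rewrite rP => V VV VP; exists (sqrtC 2 *: V).
have s2 : (sqrtC 2 : C)^* = sqrtC 2 by apply/CrealP/ger0_real; rewrite sqrtC_ge0.
rewrite adjmxZ s2 -!scalemxAl -!scalemxAr VV VP !scalerA -expr2 sqrtCK.
by rewrite scalemx1 mulfV // scale1r.
Qed.

Local Open Scope complex_scope.

Lemma modulusE (R : realType) (z : R[i]) : (modulus z)%:C = `|z|.
Proof. by []. Qed.

Lemma modulus_ge0 (R : realType) (z : R[i]) : 0 <= modulus z.
Proof. by rewrite -lecR modulusE normr_ge0. Qed.

Lemma modulus_sqr (R : realType) (z : R[i]) : (modulus z ^+ 2)%:C = z * (z^* )%R.
Proof. by rewrite rmorphXn /= modulusE normCK. Qed.

(** The unit-norm condition in terms of the diagonal of the Gram matrix, where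
    it can be combined with matrix identities. *)
Lemma enorm_eq1 (R : realType) (d : nat) (u : 'cV[R[i]]_d) :
  enorm u = 1 <-> cdot u u = 1.
Proof.
have -> : cdot u u = (\sum_(k < d) modulus (u k 0) ^+ 2)%:C.
  rewrite /cdot mxE rmorph_sum /=; apply: eq_bigr => k _.
  by rewrite !mxE modulus_sqr mulrC.
rewrite /enorm; set s := \sum_(k < d) _.
have s0 : 0 <= s by apply: sumr_ge0 => k _; rewrite sqr_ge0.
split=> [E | /(@complexI R s 1) ->]; last by rewrite sqrtr1.
by rewrite -(sqr_sqrtr s0) E expr1n.
Qed.

Lemma cdot_col (R : realType) (d n : nat) (F : 'M[R[i]]_(d, n)) i j :
  cdot (col i F) (col j F) = (F^t* *m F) i j.
Proof. by rewrite /cdot !mxE; apply: eq_bigr => k _; rewrite !mxE. Qed.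

Lemma welch_ge0 (R : realType) (d n : nat) : 0 <= welch R d n.
Proof. exact: sqrtr_ge0. Qed.

Lemma welch_double (R : realType) (d : nat) : (0 < d)%N ->
  welch R d (d + d) = 1 / Num.sqrt ((d + d)%:R - 1).
Proof.
move=> d0; have d_neq0 : d%:R != 0 :> R by rewrite pnatr_eq0 -lt0n.
have lt1 : 1 < (d + d)%:R :> R by rewrite ltr1n -addn1 leq_add.
rewrite /welch natrD addrK -natrD invfM mulrA mulfV // mul1r mul1r sqrtrV //.
by rewrite subr_ge0 ltW.
Qed.

Lemma etf_of_hermitian_conference (R : realType) (d : nat)
    (S : 'M[R[i]]_(d + d)) : (0 < d)%N -> hermitian_conference S ->
  exists F : 'M[R[i]]_(d, d + d), is_etf F.
Proof.
move=> d0 [Sherm Sdiag Snorm SS].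
pose m := welch R d (d + d).
have d_neq0 : d%:R != 0 :> R[i] by rewrite pnatr_eq0 -lt0n.
have m2 : (m * m) * ((d + d)%:R - 1) = 1 :> R.
  have gt0 : 0 < (d + d)%:R - 1 :> R by rewrite subr_gt0 ltr1n -addn1 leq_add.
  rewrite /m welch_double // mul1r -invfM -expr2 sqr_sqrtr ?ltW //.
  by rewrite mulVf // gt_eqF.
have mJ : (m%:C^* )%R = m%:C by apply/CrealP/ger0_real; rewrite ler0c welch_ge0.
have m2C : m%:C * m%:C * ((d + d)%:R - 1) = 1.
  have := congr1 (real_complex R) m2.
  by rewrite !rmorphM rmorphB /= rmorph_nat rmorph1.
have [F [FF Gram]] := tight_frame_of_conference Sherm Sdiag SS mJ m2C.
exists F; split.
- by rewrite d0 -[X in (X < _)%N]addn0 ltn_add2l.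
- by move=> j; apply/enorm_eq1; rewrite cdot_col Gram !mxE eqxx Sdiag mulr0 addr0.
- move=> i j ij; apply: complexI; rewrite modulusE cdot_col Gram !mxE (negPf ij).
  by rewrite add0r normrM Snorm // mulr1 ger0_norm // ler0c welch_ge0.
- by rewrite FF natrD; congr (_%:M); field.
Qed.

(** * The Welch bound *)

Lemma mxtrace_adjM (C : numClosedFieldType) m n (A : 'M[C]_(m, n)) :
  \tr (A^t* *m A) = \sum_i \sum_j `|A i j| ^+ 2.
Proof.
rewrite exchange_big; apply: eq_bigr => j _; rewrite !mxE; apply: eq_bigr => i _.
by rewrite !mxE mulrC normCK.
Qed.

(** The Gram matrix F^* F and the frame operator A = F F^* have the same trace n
    and the same Frobenius norm, and A is only of order d.  The claim says that
    the Frobenius norm of A - (n / d) I is nonnegative. *)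
Lemma gram_energy_ge (C : numClosedFieldType) (d n : nat) (F : 'M[C]_(d, n)) :
    (0 < d)%N -> (forall j, (F^t* *m F) j j = 1) ->
  n%:R ^+ 2 / d%:R <= \sum_i \sum_j `|(F^t* *m F) i j| ^+ 2.
Proof.
move=> d0 Fdiag; have d_neq0 : d%:R != 0 :> C by rewrite pnatr_eq0 -lt0n.
pose a : C := n%:R / d%:R; pose A := F *m F^t*.
have Aherm : A^t* = A by rewrite adjmxM adjmxK.
have trA : \tr A = n%:R.
  rewrite mxtrace_mulC /mxtrace (eq_bigr _ (fun j _ => Fdiag j)).
  by rewrite sumr_const card_ord.
have aJ : (a^* )%R = a by rewrite fmorph_div !rmorph_nat.
have : 0 <= \tr ((A - a%:M)^t* *m (A - a%:M)).
  by rewrite mxtrace_adjM; do 2!apply: sumr_ge0 => ? _; rewrite exprn_ge0.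
have -> : (A - a%:M)^t* = A - a%:M.
  by apply/matrixP=> i j; rewrite -[in RHS]Aherm !mxE rmorphB rmorphMn /= aJ eq_sym.
rewrite mulmxBl !mulmxBr !mul_mx_scalar !mul_scalar_mx scale_scalar_mx.
rewrite !raddfB /= !mxtraceZ mxtrace_scalar trA.
have -> : \tr (A *m A) = \sum_i \sum_j `|(F^t* *m F) i j| ^+ 2.
  rewrite -[RHS]mxtrace_adjM adjmxM adjmxK -[in RHS]mulmxA [RHS]mxtrace_mulC.
  by rewrite /A !mulmxA.
have -> : a * a *+ d = a * n%:R by rewrite -mulr_natr -mulrA divfK.
rewrite opprK addNr addr0 subr_ge0; congr (_ <= _).
by rewrite /a expr2 mulrAC.
Qed.

Lemma modulus_le_coherence (R : realType) (d n : nat) (F : 'M[R[i]]_(d, n)) i j :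
  i != j -> modulus (cdot (col i F) (col j F)) <= coherence F.
Proof.
move=> ij; apply: (le_bigmax_cond 0 (fun p : 'I_n * 'I_n =>
  modulus (cdot (col p.1 F) (col p.2 F))) (j := (i, j))) => //.
Qed.

(** Among the n^2 squared moduli that [gram_energy_ge] bounds from below, n are
    equal to 1 and the others are at most the square of the coherence. *)
Lemma welch_le_coherence (R : realType) (d n : nat) (F : 'M[R[i]]_(d, n)) :
  (0 < d)%N -> (1 < n)%N -> unit_columns F -> welch R d n <= coherence F.
Proof.
move=> d0 n1 Funit; set c := coherence F.
have c0 : 0 <= c.
  have neq : Ordinal (ltnW n1) != Ordinal n1 by [].
  exact: le_trans (modulus_ge0 _) (modulus_le_coherence F neq).
have Fdiag j : (F^t* *m F) j j = 1 by rewrite -cdot_col; apply/enorm_eq1/Funit.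
have energy : n%:R ^+ 2 / d%:R <= n%:R * (1 + (n%:R - 1) * c ^+ 2) :> R.
  rewrite -lecR rmorphM fmorphV rmorphXn /= !rmorph_nat.
  apply: le_trans (gram_energy_ge d0 Fdiag) _.
  have -> : n%:R * (1 + (n%:R - 1) * c ^+ 2) =
            \sum_(i < n) (1 + \sum_(j < n | j != i) c ^+ 2).
    under eq_bigr => i _ do rewrite (sumr_const (predC1 i)) cardC1 card_ord.
    rewrite sumr_const card_ord -[n in n%:R - 1](ltn_predK n1) -natr1 addrK.
    by rewrite !mulr_natl.
  rewrite rmorph_sum; apply: ler_sum => i _.
  rewrite (bigD1 i) //= Fdiag normr1 expr1n rmorphD rmorph1 lerD2l rmorph_sum.
  apply: ler_sum => j ji; rewrite -cdot_col -modulusE -rmorphXn lecR.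
  by rewrite ler_sqr ?nnegrE ?modulus_ge0 // modulus_le_coherence // eq_sym.
rewrite -[leRHS]ger0_norm // -sqrtr_sqr; apply: ler_wsqrtr.
have d_gt0 : 0 < d%:R :> R by rewrite ltr0n.
have n_gt0 : 0 < n%:R :> R by rewrite ltr0n ltnW.
have n1_gt0 : 0 < n%:R - 1 :> R by rewrite subr_gt0 ltr1n.
rewrite ler_pdivrMr ?mulr_gt0 //.
move: energy; rewrite ler_pdivrMr // expr2 -!mulrA ler_pM2l // => energy.
rewrite -subr_ge0; move: energy; rewrite -subr_ge0.
by congr (0 <= _); ring.
Qed.

(** All the terms of the maximum equal the Welch bound, which is also a lower
    bound of the coherence; the latter covers the default value 0 of the
    maximum. *)
Lemma coherence_etf (R : realType) (d n : nat) (F : 'M[R[i]]_(d, n)) :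
  is_etf F -> coherence F = welch R d n.
Proof.
case=> /andP[d0 dn] Funit Fangle _; apply: le_anti.
rewrite welch_le_coherence ?(leq_ltn_trans d0 dn) // andbT.
by apply: bigmax_le => [|[i j] /= ij]; rewrite ?welch_ge0 // Fangle.
Qed.

Theorem theorem2 (R : realType) (d : nat) (hd : (1 <= d)%N)
    (hH : exists H : 'M[int]_(d + 1), skew_hadamard H) :
  [/\ exists F : 'M[R[i]]_(d, 2 * d), is_etf F,
      exists F : 'M[R[i]]_(d, 2 * d),
        [/\ unit_columns F,
            coherence F = welch R d (2 * d)
          & forall G : 'M[R[i]]_(d, 2 * d),
              unit_columns G -> coherence F <= coherence G]
    & welch R d (2 * d) = 1 / Num.sqrt ((2 * d)%:R - 1)].
Proof.
rewrite mul2n -addnn.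
have [H /skew_hadamard_core[Q /(hermitian_conference_of_core R[i] hd)]] := hH.
case=> S /(etf_of_hermitian_conference hd)[F etfF].
have [dn Funit _ _] := etfF.
split; [by exists F | exists F; split=> // | exact: welch_double].
  exact: coherence_etf.
move=> G Gunit; rewrite coherence_etf // welch_le_coherence //.
exact: (leq_add hd hd).
Qed.
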